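(* Suppose that $g(u,x)$ is affine in $u$ (on $\mathbf{R}^m$, for every $x\in\mathcal X$) and that the worst-case constraint value is not affected by the support constraint, i.e. $\bar g^N(x)=\bar g^{N*}(x)$ for every $x\in\mathcal X$ with $\bar g^N(x)\le 0$. Let $p\ge1$ be an integer. Then clustering makes no difference to the optimal value and optimal solutions of the mean robust optimization problem: for every $K\leq N$ and every partition of the data into $K$ clusters, the problem $$\text{minimize } f(x)\quad\text{subject to } x\in\mathcal X,\ \bar g^K(x)\le 0$$ has the same optimal value and the same optimal solutions as the problem $$\text{minimize } f(x)\quad\text{subject to } x\in\mathcal X,\ \bar g^N(x)\le 0 .$$
   Context: $\mathcal X\subseteq\mathbf{R}^n$ is compact, $f$ is an objective function on $\mathcal X$, $S\subseteq\mathbf{R}^m$ is convex and closed, $g:\mathbf{R}^m\times\mathcal X\to\mathbf{R}$. Data points $d_1,\dots,d_N\in S$ are partitioned into $K$ disjoint nonempty clusters with index sets $C_1,\dots,C_K$, with means $\bar d_k=\frac1{|C_k|}\sum_{i\in C_k}d_i$. $\|\cdot\|$ is a norm on $\mathbf{R}^m$ and $\epsilon>0$. Define $$\bar g^N(x)=\max\Big\{\tfrac1N\sum_{i=1}^N g(v_i,x)\ :\ \tfrac1N\sum_{i=1}^N\|v_i-d_i\|^p\le\epsilon^p,\ v_i\in S,\ i=1,\dots,N\Big\},$$ $$\bar g^K(x)=\max\Big\{\sum_{k=1}^K\tfrac{|C_k|}{N}g(u_k,x)\ :\ \sum_{k=1}^K\tfrac{|C_k|}{N}\|u_k-\bar d_k\|^p\le\epsilon^p,\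 u_k\in S,\ k=1,\dots,K\Big\},$$ $$\bar g^{N*}(x)=\max\Big\{\tfrac1N\sum_{i=1}^N g(v_i,x)\ :\ \tfrac1N\sum_{i=1}^N\|v_i-d_i\|^p\le\epsilon^p\Big\}\quad\text{(no support constraint)}.$$ *)

(* Defs.v *)
From HB Require Import structures.
From mathcomp Require Import all_boot all_order all_algebra.
From mathcomp Require Import all_classical all_reals all_analysis.

Set Implicit Arguments.
Unset Strict Implicit.
Unset Printing Implicit Defensive.

Import Order.TTheory GRing.Theory Num.Theory.
Import numFieldNormedType.Exports.

Local Open Scope classical_set_scope.
Local Open Scope ring_scope.

(* An arbitrary norm on R^m, unrelated to the sup norm that the library attaches
   canonically to row vectors. *)
Record is_norm (R : realType) (m : nat) (nrm : 'rV[R]_m -> R) : Prop := IsNorm {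
  norm_definite : forall u, nrm u = 0 -> u = 0 ;
  norm_homogeneous : forall (a : R) u, nrm (a *: u) = `|a| * nrm u ;
  norm_triangle : forall u v, nrm (u + v) <= nrm u + nrm v }.

Definition affine (R : realType) (m : nat) (h : 'rV[R]_m -> R) : Prop :=
  exists (l : {scalar 'rV[R]_m}) (c : R), forall u, h u = l u + c.

Definition is_clustering (N K : nat) (C : 'I_K -> {set 'I_N}) : Prop :=
  [/\ forall k, C k <> finset.set0,
      forall k l, k != l -> (C k :&: C l)%SET = finset.set0
    & forall i, exists k, i \in C k].

Definition cluster_mean (R : realType) (m N K : nat) (d : 'I_N -> 'rV[R]_m)
    (C : 'I_K -> {set 'I_N}) (k : 'I_K) : 'rV[R]_m :=
  #|C k|%:R^-1 *: \sum_(i in C k) d i.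

(* The three worst-case values are suprema in the extended reals, which makes
   them total; the supremum is the maximum whenever the latter is attained, as
   is the case when g is affine in its first argument and S is closed. *)

Definition gbarN (R : realType) (m n : nat) (S : set 'rV[R]_m)
    (g : 'rV[R]_m -> 'rV[R]_n -> R) (nrm : 'rV[R]_m -> R) (eps : R) (p : nat)
    (N : nat) (d : 'I_N -> 'rV[R]_m) (x : 'rV[R]_n) : \bar R :=
  ereal_sup [set (N%:R^-1 * \sum_(i < N) g (v i) x)%:E
    | v in [set v : 'I_N -> 'rV[R]_m |
        N%:R^-1 * \sum_(i < N) nrm (v i - d i) ^+ p <= eps ^+ p
        /\ forall i, S (v i)]].

Definition gbarK (R : realType) (m n : nat) (S : set 'rV[R]_m)
    (g : 'rV[R]_m -> 'rV[R]_n -> R) (nrm : 'rV[R]_m -> R) (eps : R) (p : nat)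
    (N K : nat) (d : 'I_N -> 'rV[R]_m) (C : 'I_K -> {set 'I_N})
    (x : 'rV[R]_n) : \bar R :=
  ereal_sup [set (\sum_(k < K) #|C k|%:R / N%:R * g (u k) x)%:E
    | u in [set u : 'I_K -> 'rV[R]_m |
        \sum_(k < K) #|C k|%:R / N%:R * nrm (u k - cluster_mean d C k) ^+ p
          <= eps ^+ p
        /\ forall k, S (u k)]].

Definition gbarNstar (R : realType) (m n : nat)
    (g : 'rV[R]_m -> 'rV[R]_n -> R) (nrm : 'rV[R]_m -> R) (eps : R) (p : nat)
    (N : nat) (d : 'I_N -> 'rV[R]_m) (x : 'rV[R]_n) : \bar R :=
  ereal_sup [set (N%:R^-1 * \sum_(i < N) g (v i) x)%:E
    | v in [set v : 'I_N -> 'rV[R]_m |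
        N%:R^-1 * \sum_(i < N) nrm (v i - d i) ^+ p <= eps ^+ p]].

Definition feasible (R : realType) (n : nat) (X : set 'rV[R]_n)
    (gbar : 'rV[R]_n -> \bar R) : set 'rV[R]_n :=
  [set x | X x /\ (gbar x <= 0)%E].

(* +oo when the problem is infeasible, -oo when it is unbounded below *)
Definition optimal_value (R : realType) (n : nat) (f : 'rV[R]_n -> R)
    (X : set 'rV[R]_n) (gbar : 'rV[R]_n -> \bar R) : \bar R :=
  ereal_inf [set (f x)%:E | x in feasible X gbar].

Definition optimal_solutions (R : realType) (n : nat) (f : 'rV[R]_n -> R)
    (X : set 'rV[R]_n) (gbar : 'rV[R]_n -> \bar R) : set 'rV[R]_n :=
  [set x | feasible X gbar x /\ forall y, feasible X gbar y -> f x <= f y].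

(* Main.v *)
Require Import Defs.
From HB Require Import structures.
From mathcomp Require Import all_boot all_order all_algebra.
From mathcomp Require Import all_classical all_reals all_analysis.
From mathcomp Require Import ring.
Import Order.TTheory GRing.Theory Num.Theory.
Import numFieldNormedType.Exports.
Local Open Scope classical_set_scope.
Local Open Scope ring_scope.

(** Both problems minimize [f], so it suffices that the two constraints cut out
    the same subset of [X]; two comparisons of worst-case values give this.

    Averaging within clusters gives [gbarN <= gbarK] ([gbarN_le_gbarK]).  If [v]
    is admissible for the data, then its cluster means are admissible for the
    clustered data: they lie in the convex set [S], and their transport cost
    does not exceed that of [v] by Jensen's inequality for the convex function
    [u |-> nrm u ^+ p] ([norm_mean_expr_le]).  An affine function takes the same
    average on the cluster means as on [v] ([affine_cluster_mean]), so the
    objective is unchanged.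

    Conversely, [gbarK <= gbarNstar] ([gbarK_le_gbarNstar]): translate every data
    point of cluster [k] by the displacement [u k - cluster_mean d C k].  The
    cost is unchanged, and the translated points have cluster means [u], so the
    objective is unchanged as well.  The translated points may leave [S], which
    is why this bound is by [gbarNstar].  When [gbarN x <= 0] the hypothesis on
    the support closes the loop, as [gbarK x <= gbarNstar x = gbarN x <= 0]. *)

Set Implicit Arguments.
Unset Strict Implicit.
Unset Printing Implicit Defensive.

(** * Means: convex sets, powers and norms *)

(** Binary convex combinations suffice because the mean of [i :: s] is the
    combination of the first point and the mean of [s] with weight
    [1 / size (i :: s)]. *)
Lemma convex_set_mean (R : realType) (M : lmodType R) (A : set M) :
  convex_set A -> forall (I : eqType) (s : seq I) (w : I -> M),
  (0 < size s)%N -> {in s, forall i, A (w i)} ->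
  A ((size s)%:R^-1 *: \sum_(i <- s) w i).
Proof.
move=> cA I s w; elim: s => // i s IHs _ Aw.
have Awi : A (w i) by apply: Aw; rewrite mem_head.
rewrite big_cons; have [s0|s_gt0] := posnP (size s).
  by rewrite (size0nil s0) big_nil addr0 invr1 scale1r.
have {}IHs : A ((size s)%:R^-1 *: \sum_(j <- s) w j).
  by apply: IHs => // j js; apply: Aw; rewrite in_cons js orbT.
have t_ge0 : 0 <= ((size s).+1%:R^-1 : R) by rewrite invr_ge0 ler0n.
have t_le1 : ((size s).+1%:R^-1 : R) <= 1 by rewrite invf_le1 ?ltr0n// ler1n.
have := cA (w i) _ (Itv01 t_ge0 t_le1) (mem_set Awi) (mem_set IHs).
move=> /set_mem; congr A.
rewrite /conv/= scalerDr scalerA; congr (_ + _ *: _).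
have sn0 : (size s)%:R != 0 :> R by rewrite pnatr_eq0 -lt0n.
have s1n0 : (size s).+1%:R != 0 :> R by rewrite pnatr_eq0.
by rewrite /unstable.onem -natr1; field; rewrite sn0 natr1 s1n0.
Qed.

(** The graph of a power lies above its tangent at [c] on the nonnegative
    half-line.  By induction on [q]: [a] times the lower bound for [q] exceeds
    the lower bound for [q.+1] by [q.+1%:R * c ^+ q * (a - c) ^+ 2]. *)
Lemma expr_ge_tangent (R : realType) (a c : R) (q : nat) : 0 <= a -> 0 <= c ->
  c ^+ q.+1 + q.+1%:R * c ^+ q * (a - c) <= a ^+ q.+1.
Proof.
move=> a0 c0; elim: q => [|q IHq].
  by rewrite expr0 !expr1 !mul1r addrC subrK.
rewrite [leRHS]exprS; apply: le_trans (ler_wpM2l a0 IHq).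
rewrite -subr_ge0.
have -> : a * (c ^+ q.+1 + q.+1%:R * c ^+ q * (a - c)) -
    (c ^+ q.+2 + q.+2%:R * c ^+ q.+1 * (a - c)) =
    q.+1%:R * c ^+ q * (a - c) ^+ 2.
  by rewrite -[q.+2%:R]natr1 !exprS; ring.
by rewrite mulr_ge0 ?sqr_ge0 ?mulr_ge0 ?exprn_ge0.
Qed.

(** Averaging the tangent bound at the mean, where the linear term averages
    to zero. *)
Lemma expr_mean_le (R : realType) (I : finType) (A : {set I}) (a : I -> R)
    (p : nat) : (1 <= p)%N -> A != finset.set0 -> (forall i, 0 <= a i) ->
  (#|A|%:R^-1 * \sum_(i in A) a i) ^+ p
    <= #|A|%:R^-1 * \sum_(i in A) a i ^+ p.
Proof.
case: p => // q _ A0 a_ge0; set c := #|A|%:R^-1 * _.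
have cA_gt0 : 0 < #|A|%:R :> R by rewrite ltr0n card_gt0.
have c_ge0 : 0 <= c by rewrite mulr_ge0 ?invr_ge0 ?ler0n ?sumr_ge0.
rewrite -(ler_pM2l cA_gt0) mulrA divff ?gt_eqF// mul1r.
apply: le_trans (ler_sum _ (fun i _ => expr_ge_tangent q (a_ge0 i) c_ge0)).
rewrite big_split/= sumr_const -mulr_sumr sumrB sumr_const.
have -> : \sum_(i in A) a i = c *+ #|A|.
  by rewrite -mulr_natl /c mulrA divff ?gt_eqF// mul1r.
by rewrite subrr mulr0 addr0 mulr_natl.
Qed.

Section Norm.
Context (R : realType) (m : nat) (nrm : 'rV[R]_m -> R) (hnrm : is_norm nrm).

Lemma norm_zero : nrm 0 = 0.
Proof. by rewrite -(scale0r 0) (norm_homogeneous hnrm) normr0 mul0r. Qed.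

Lemma norm_nonneg u : 0 <= nrm u.
Proof.
have := norm_triangle hnrm u (-1 *: u).
rewrite (norm_homogeneous hnrm) normrN1 mul1r scaleN1r subrr norm_zero.
by rewrite -mulr2n pmulrn_lge0.
Qed.

Lemma norm_sum_le (I : finType) (A : {set I}) (w : I -> 'rV[R]_m) :
  nrm (\sum_(i in A) w i) <= \sum_(i in A) nrm (w i).
Proof.
elim/big_ind2 : _ => [|a u b v au bv|//]; first by rewrite norm_zero.
exact: le_trans (norm_triangle hnrm _ _) (lerD au bv).
Qed.

(** Jensen's inequality for [u |-> nrm u ^+ p] and uniform weights. *)
Lemma norm_mean_expr_le (I : finType) (A : {set I}) (w : I -> 'rV[R]_m)
    (p : nat) : (1 <= p)%N -> A != finset.set0 ->
  nrm (#|A|%:R^-1 *: \sum_(i in A) w i) ^+ p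
    <= #|A|%:R^-1 * \sum_(i in A) nrm (w i) ^+ p.
Proof.
move=> p1 A0.
apply: le_trans (expr_mean_le p1 A0 (fun i => norm_nonneg (w i))).
have c_ge0 : 0 <= #|A|%:R^-1 :> R by rewrite invr_ge0 ler0n.
rewrite lerXn2r ?nnegrE ?norm_nonneg//.
  by rewrite mulr_ge0 ?sumr_ge0// => i _; exact: norm_nonneg.
by rewrite (norm_homogeneous hnrm) ger0_norm// ler_wpM2l ?norm_sum_le.
Qed.

End Norm.

Lemma affine_mean (R : realType) (m : nat) (h : 'rV[R]_m -> R) (I : finType)
    (A : {set I}) (w : I -> 'rV[R]_m) : affine h -> A != finset.set0 ->
  h (#|A|%:R^-1 *: \sum_(i in A) w i) = #|A|%:R^-1 * \sum_(i in A) h (w i).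
Proof.
move=> [l [c hE]] A0.
have cA0 : #|A|%:R != 0 :> R by rewrite pnatr_eq0 cards_eq0.
rewrite hE linearZ/= linear_sum (eq_bigr _ (fun i _ => hE (w i))) big_split/=.
by rewrite sumr_const mulrDr -[c *+ _]mulr_natl mulKf.
Qed.

(** * Averaging over a clustering *)

Section Clustering.
Context (R : realType) (m N K : nat) (C : 'I_K -> {set 'I_N}).
Hypothesis hC : is_clustering C.

Lemma cluster_neq0 k : C k != finset.set0.
Proof. by case: hC => C0 _ _; apply/eqP; exact: C0. Qed.

Lemma cluster_card_neq0 k : #|C k|%:R != 0 :> R.
Proof. by rewrite pnatr_eq0 cards_eq0 cluster_neq0. Qed.

Lemma sum_clusters (F : 'I_N -> R) :
  \sum_(i < N) F i = \sum_(k < K) \sum_(i in C k) F i.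
Proof.
case: hC => _ dC cC; rewrite -partition_disjoint_bigcup/=; last first.
  by move=> k l kl; rewrite -setI_eq0; apply/eqP; exact: dC.
apply: eq_bigl => i; apply/esym/finset.bigcupP.
by have [k ik] := cC i; exists k.
Qed.

Lemma weighted_sum_clusters (F : 'I_N -> R) :
  \sum_(k < K) #|C k|%:R / N%:R * (#|C k|%:R^-1 * \sum_(i in C k) F i)
    = N%:R^-1 * \sum_(i < N) F i.
Proof.
rewrite sum_clusters mulr_sumr; apply: eq_bigr => k _.
by rewrite mulrA [_ / N%:R]mulrC mulfK// cluster_card_neq0.
Qed.

Lemma cluster_label : exists lab : 'I_N -> 'I_K,
  forall k i, i \in C k -> lab i = k.
Proof.
case: hC => _ dC cC; have [lab labP] := choice cC.
exists lab => k i ik; apply/eqP/negPn/negP => /dC /setP/(_ i).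
by rewrite !inE labP ik.
Qed.

Lemma affine_cluster_mean (h : 'rV[R]_m -> R) (v : 'I_N -> 'rV[R]_m) :
  affine h ->
  \sum_(k < K) #|C k|%:R / N%:R * h (cluster_mean v C k)
    = N%:R^-1 * \sum_(i < N) h (v i).
Proof.
move=> h_aff; rewrite -weighted_sum_clusters; apply: eq_bigr => k _.
by rewrite -affine_mean// cluster_neq0.
Qed.

Lemma cluster_mean_convex (S : set 'rV[R]_m) (v : 'I_N -> 'rV[R]_m) k :
  convex_set S -> (forall i, S (v i)) -> S (cluster_mean v C k).
Proof.
move=> cS Sv; have := @convex_set_mean _ _ _ cS _ (enum (C k)) v.
rewrite -cardE big_enum; apply => [|i _]; last exact: Sv.
by rewrite card_gt0 cluster_neq0.
Qed.

(** Jensen's inequality within each cluster, since the difference of two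
    cluster means is the mean of the differences. *)
Lemma cluster_mean_cost_le (nrm : 'rV[R]_m -> R) (p : nat)
    (v d : 'I_N -> 'rV[R]_m) : is_norm nrm -> (1 <= p)%N ->
  \sum_(k < K) #|C k|%:R / N%:R *
      nrm (cluster_mean v C k - cluster_mean d C k) ^+ p
    <= N%:R^-1 * \sum_(i < N) nrm (v i - d i) ^+ p.
Proof.
move=> hnrm p1; rewrite -weighted_sum_clusters; apply: ler_sum => k _.
rewrite ler_wpM2l ?divr_ge0 ?ler0n// /cluster_mean -scalerBr -sumrB.
by apply: norm_mean_expr_le; rewrite ?cluster_neq0.
Qed.

(** * Comparison of the worst-case values *)

Context (n : nat) (g : 'rV[R]_m -> 'rV[R]_n -> R) (nrm : 'rV[R]_m -> R).
Context (S : set 'rV[R]_m) (eps : R) (p : nat).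
Context (d : 'I_N -> 'rV[R]_m) (x : 'rV[R]_n).
Hypothesis g_affine : affine (fun u => g u x).

(** Cluster means of an admissible [v] are admissible and give the same
    objective. *)
Lemma gbarN_le_gbarK : convex_set S -> is_norm nrm -> (1 <= p)%N ->
  (gbarN S g nrm eps p d x <= gbarK S g nrm eps p d C x)%E.
Proof.
move=> cS hnrm p1; apply: ub_ereal_sup => _ [v [v_cost v_S] <-].
apply: ereal_sup_ubound; exists (cluster_mean v C); last first.
  by rewrite (affine_cluster_mean v g_affine).
split; first exact: le_trans (cluster_mean_cost_le _ _ hnrm p1) v_cost.
by move=> k; exact: cluster_mean_convex.
Qed.

(** Moving each cluster rigidly so that its mean becomes [u k] preserves both
    cost and objective, but may leave [S]. *)
Lemma gbarK_le_gbarNstar :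
  (gbarK S g nrm eps p d C x <= gbarNstar g nrm eps p d x)%E.
Proof.
have [lab labE] := cluster_label.
apply: ub_ereal_sup => _ [u [u_cost _] <-]; apply: ereal_sup_ubound.
pose v i := d i + (u (lab i) - cluster_mean d C (lab i)).
have mean_v k : cluster_mean v C k = u k.
  rewrite {1}/cluster_mean.
  under eq_bigr => i ik do rewrite /v (labE k i ik).
  rewrite big_split/= scalerDr sumr_const -[(_ - _) *+ _]scaler_nat scalerA.
  by rewrite mulVf ?cluster_card_neq0// scale1r addrC subrK.
exists v => /=; last first.
  rewrite -(affine_cluster_mean v g_affine); congr (_%:E).
  by apply: eq_bigr => k _; rewrite mean_v.
apply: le_trans u_cost; rewrite -weighted_sum_clusters; apply: ler_sum => k _.
(* On a cluster all displacements [v i - d i] agree. *)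
under eq_bigr => i ik do rewrite /v addrC addKr (labE k i ik).
by rewrite sumr_const -[_ ^+ p *+ _]mulr_natl mulKf ?cluster_card_neq0.
Qed.

End Clustering.

Theorem corollary4p1p2 (R : realType) (m n : nat)
    (X : set 'rV[R]_n) (hX : compact X)
    (f : 'rV[R]_n -> R)
    (S : set 'rV[R]_m) (hSconvex : convex_set S) (hSclosed : closed S)
    (g : 'rV[R]_m -> 'rV[R]_n -> R)
    (nrm : 'rV[R]_m -> R) (hnrm : is_norm nrm)
    (eps : R) (heps : 0 < eps)
    (p : nat) (hp : (1 <= p)%N)
    (N : nat) (hN : (0 < N)%N)
    (d : 'I_N -> 'rV[R]_m) (hd : forall i, S (d i))
    (haffine : forall x, X x -> affine (fun u => g u x))
    (hsupport : forall x, X x ->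
       (gbarN S g nrm eps p d x <= 0)%E ->
       gbarN S g nrm eps p d x = gbarNstar g nrm eps p d x) :
  forall (K : nat) (C : 'I_K -> {set 'I_N}),
    (K <= N)%N -> is_clustering C ->
    optimal_value f X (gbarK S g nrm eps p d C)
      = optimal_value f X (gbarN S g nrm eps p d)
    /\ optimal_solutions f X (gbarK S g nrm eps p d C)
      = optimal_solutions f X (gbarN S g nrm eps p d).
Proof.
move=> K C _ hC.
have feasE : feasible X (gbarK S g nrm eps p d C)
    = feasible X (gbarN S g nrm eps p d).
  apply/seteqP; split=> x [Xx gx0]; split=> //.
    apply: le_trans gx0.
    by apply: gbarN_le_gbarK; [|exact: haffine| | |].
  apply: le_trans (gbarK_le_gbarNstar hC nrm S eps p d (haffine _ Xx)) _.
  by rewrite -hsupport.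
by rewrite /optimal_value /optimal_solutions feasE.
Qed.
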